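(* Let $n\ge 2$ be even and consider a separately specified credal network over variables $X_1,\dots,X_{n+1}$ that is an imprecise hidden Markov model whose state nodes are the odd numbers and whose manifest nodes are the even numbers. That is, its directed graph on $\{1,\dots,n+1\}$ has exactly the arcs $i-1\to i$ and $i-1\to i+1$ for every even $i\in\{2,4,\dots,n\}$, so the state nodes form the chain $1\to 3\to\cdots\to n+1$ and each manifest node $i$ is a leaf with the single parent $i-1$. Let the query node be $q=n+1$, let $O$ be a subset of the manifest nodes, and let $\tilde x_O$ be an assignment to $X_O$ such that $\min_{p\in C(X)}p(\tilde x_O)>0$ both for $C(X)$ the strong extension and for $C(X)$ the epistemic extension of the network. Then for every function $f:\mathcal X_q\to\mathbb R$, the posterior lower expectation $\min_{p\in C(X_q|\tilde x_O)}\mathbb E_p[f]$ has the same value whether $C(X)$ is the epistemic extension (epistemic irrelevance) or the strong extension (strong independence) of the network.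
   Context: Let $X_1,\dots,X_m$ be variables with values in finite sets $\mathcal X_1,\dots,\mathcal X_m$, put $N=\{1,\dots,m\}$, $X=(X_1,\dots,X_m)$ and $\mathcal X=\mathcal X_1\times\dots\times\mathcal X_m$. For $I\subseteq N$, $X_I$ and $x_I$ denote the restrictions to the coordinates in $I$. A probability mass function (pmf) on a finite set $\mathcal Z$ is a non-negative real function on $\mathcal Z$ summing to 1, and $\mathbb E_p[f]=\sum_z f(z)p(z)$. A credal set is a closed convex set of pmfs on a finite set; all credal sets specified in a network have finitely many extreme points; $\mathrm{ext}$ denotes the set of extreme points and $\mathrm{co}$ the convex closure. Given a credal set $C(X)$ of pmfs on $\mathcal X$, disjoint $I,J\subseteq N$ and an assignment $x_J$, the conditional credal set is $C(X_I|x_J)=\mathrm{co}\{p(X_I|x_J): p\in C(X),\ p(x_J)>0\}$. For an acyclic directed graph on $N$, $\mathrm{pa}(i)$ is the set of parents of $i$ and $\mathrm{nd}(i)$ (the non-descendants of $i$) is the set of nodes other than $i$ not reachable from $i$ by a directed path. A separately specified credal network consists of an acyclic directed graph on $N$, a variable $X_i$ for each node $i$, and for each node $i$ and each value $x_{\mathrm{pa}(i)}$ a (non-empty) local credal set $Q(X_i|x_{\mathrm{pa}(i)})$ of pmfs on $\mathcal X_i$. The strong extension is the convex hull of all pmfs $p$ on $\mathcal X$ of the form $p(x)=\prod_{i\in N}q(x_i|x_{\mathrm{pa}(i)})$ where $q(X_i|x_{\mathrm{pa}(i)})\in\mathrm{ext}\,Q(X_i|x_{\mathrm{pa}(i)})$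 is chosen separately for each $i$ and each $x_{\mathrm{pa}(i)}$. The epistemic extension is the set of all pmfs $p$ on $\mathcal X$ such that for every $i\in N$ and every $x_{\mathrm{nd}(i)}$ with $p(x_{\mathrm{nd}(i)})>0$ one has $p(X_i|x_{\mathrm{nd}(i)})\in Q(X_i|x_{\mathrm{pa}(i)})$. *)

(* Defs.v *)
From HB Require Import structures.
From mathcomp Require Import all_boot all_order all_algebra.
From mathcomp Require Import all_classical all_reals all_analysis.

Set Implicit Arguments.
Unset Strict Implicit.
Unset Printing Implicit Defensive.

Import Order.TTheory GRing.Theory Num.Theory.
Import numFieldNormedType.Exports.

Local Open Scope classical_set_scope.
Local Open Scope ring_scope.

Definition is_min (R : realType) (A : set R) (v : R) : Prop :=
  A v /\ lbound A v.

Section CredalSets.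
Context {R : realType} {Z : finType}.
Implicit Types (p : Z -> R) (C : set (Z -> R)).

Definition is_pmf p : Prop := (forall z, 0 <= p z) /\ \sum_z p z = 1.

Definition expect p (f : Z -> R) : R := \sum_z f z * p z.

(* [Z -> R] is R^Z: vector operations are pointwise, the topology is the
   product topology. *)
Definition convexZ C : Prop := @convex_set R (Z -> R^o) C.
Definition closedZ C : Prop := closed (C : set {ptws Z -> R}).

Definition credal_set C : Prop :=
  [/\ C `<=` is_pmf, closedZ C & convexZ C].

Definition ext C : set (Z -> R) :=
  [set p | C p /\ forall a b (t : R), C a -> C b -> 0 < t < 1 ->
     (forall z, p z = t * a z + (1 - t) * b z) -> a = p /\ b = p].

Definition convex_hull C : set (Z -> R) := smallest convexZ C.

Definition convex_closure C : set (Z -> R) :=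
  smallest (fun D => closedZ D /\ convexZ D) C.

Definition is_lower_expectation C (f : Z -> R) (v : R) : Prop :=
  is_min [set expect p f | p in C] v.

End CredalSets.

Section Assignments.
Context {R : realType} {N : finType} (T : N -> finType).

Definition full := {dffun forall i : N, T i}.

Definition asg (J : {set N}) := {dffun forall j : {j | j \in J}, T (val j)}.

Definition restr (J : {set N}) (x : full) : asg J :=
  [ffun j : {j | j \in J} => x (val j)].

Definition prob (p : full -> R) (J : {set N}) (y : asg J) : R :=
  \sum_(x | restr J x == y) p x.

(* p(X_i | y); meaningful only when [0 < prob p y]. *)
Definition cond (p : full -> R) (i : N) (J : {set N}) (y : asg J) : T i -> R :=
  fun a => (\sum_(x : full | (x i == a) && (restr J x == y)) p x) / prob p y.
#[global] Arguments cond p i {J} y _.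

Definition cond_credal (C : set (full -> R)) (i : N) (J : {set N})
    (y : asg J) : set (T i -> R) :=
  convex_closure [set cond p i y | p in [set p | C p /\ 0 < prob p y]].
#[global] Arguments cond_credal C i {J} y _.

End Assignments.

Section Graphs.
Context {N : finType}.
Implicit Types (g : rel N) (i j : N).

(* [g i j] is the arc i -> j; [connect] is reflexive, so self-loops are excluded. *)
Definition acyclic g : Prop := forall i j, g i j -> ~~ connect g j i.

Definition pa g i : {set N} := [set j | g j i]%SET.

Definition nd g i : {set N} := [set j | (j != i) && ~~ connect g i j]%SET.

End Graphs.

Record credal_network (R : realType) (N : finType) (T : N -> finType) :=
  CredalNetwork {
    net_arc : rel N;
    arc_acyclic : acyclic net_arc;
    local_set : forall i, asg T (pa net_arc i) -> set (T i -> R);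
    local_credal : forall i y, credal_set (@local_set i y);
    local_nonempty : forall i y, @local_set i y !=set0;
    local_finite_ext : forall i y, finite_set (ext (@local_set i y))
  }.
Arguments local_set {R N T} c {i} y _.

Section Extensions.
Context {R : realType} {N : finType} {T : N -> finType}.
Variable net : credal_network R T.

Definition strong_extension : set (full T -> R) :=
  convex_hull [set p |
    exists q : forall i, asg T (pa (net_arc net) i) -> T i -> R,
      (forall i y, ext (local_set net y) (q i y)) /\
      (forall x, p x = \prod_i q i (restr (pa (net_arc net) i) x) (x i))].

(* An assignment of positive probability to the non-descendants of i extends to
   a full assignment x, so x_nd(i) and x_pa(i) are taken as restrictions of x. *)
Definition epistemic_extension : set (full T -> R) :=
  [set p | is_pmf p /\ forall i (x : full T),
    0 < prob p (restr (nd (net_arc net) i) x) ->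
    local_set net (restr (pa (net_arc net) i) x)
      (cond p i (restr (nd (net_arc net) i) x))].

End Extensions.

Section HMM.
Context {n : nat}.

(* The nodes 1, ..., n+1 are represented by 'I_n.+1, with labels from 1. *)
Definition label (k : 'I_n.+1) : nat := k.+1.

Definition manifest (k : 'I_n.+1) : bool := ~~ odd (label k).

Definition hmm_arc (j k : 'I_n.+1) : Prop :=
  exists i : nat, [/\ (2 <= i <= n)%N, ~~ odd i, label j = i.-1 &
    label k = i \/ label k = i.+1].

End HMM.

(* Main.v *)
(* Fix v and let g(x) = [x_O = observation] (f(x_q) - v), so that E_p g has the
   sign of E_p[f(X_q) | observation] - v.  Summing out the nodes in reverse order
   n+1, ..., 1, the factor of g still to be treated always has the form
   (indicator of the earlier observations) * H(last state), because the parent of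
   every node is the last state before it.  The indicator is nonnegative, hence
   E_p g can only decrease when the conditional pmf of the current node is
   replaced by the element of its local credal set that minimises H, a choice
   that depends on the parent only and can be made extreme.  So E_p g, over the
   epistemic extension, is minimised by a vertex of the strong extension.  Taking
   v to be the infimum of the posterior expectations of the vertices gives the
   claim. *)
Require Import Defs.
From mathcomp Require Import all_boot all_order all_algebra.
From mathcomp Require Import all_classical all_reals all_analysis.
From mathcomp Require Import ring lra.
Import Order.TTheory GRing.Theory Num.Theory.
Import numFieldNormedType.Exports.
Set Implicit Arguments.
Unset Strict Implicit.
Unset Printing Implicit Defensive.
Local Open Scope classical_set_scope.
Local Open Scope ring_scope.

(** * Extreme minimisers of linear functionals over closed sets of pmfs *)

Lemma convex_comb_min (R : realFieldType) (t m a b : R) : 0 < t -> t < 1 ->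
  m = t * a + (1 - t) * b -> m <= a -> m <= b -> a = m /\ b = m.
Proof.
move=> t0 t1 mE ma mb; split.
  apply/eqP; rewrite eq_le ma andbT -subr_le0 -(pmulr_rle0 _ t0).
  have : 0 <= (1 - t) * (b - m) by rewrite mulr_ge0 ?subr_ge0// ltW.
  rewrite [in X in _ -> X]mulrBr mulrBr => ?; lra.
apply/eqP; rewrite eq_le mb andbT -subr_le0.
have t10 : 0 < 1 - t by rewrite subr_gt0.
rewrite -(pmulr_rle0 _ t10).
have : 0 <= t * (a - m) by rewrite mulr_ge0 ?subr_ge0// ltW.
rewrite [in X in _ -> X]mulrBr mulrBr => ?; lra.
Qed.

Lemma continuous_sum (R : realType) (I : finType) (T : topologicalType)
    (F : I -> T -> R) :
  (forall i, continuous (F i)) -> continuous (fun x => \sum_i F i x).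
Proof.
move=> cF; have := @continuous_big R I +%R 0 predT.
by apply => //; exact: (@add_continuous R).
Qed.

Lemma continuous_mul (R : realType) (T : topologicalType) (f g : T -> R) :
  continuous f -> continuous g -> continuous (fun x => f x * g x).
Proof. by move=> cf cg x; apply: cvgM; [exact: cf | exact: cg]. Qed.

Section ExtremeMinimizer.
Context {R : realType} {Z : finType}.
Implicit Types (p q r c : Z -> R) (C : set (Z -> R)).

Lemma eval_continuous z : continuous (fun p : {ptws Z -> R} => p z).
Proof. exact: (@proj_continuous Z (fun=> R) z). Qed.

Lemma expect_continuous c : continuous (fun p : {ptws Z -> R} => expect p c).
Proof.
apply: continuous_sum => z.
exact: (continuous_mul (@cst_continuous _ _ (c z)) (@eval_continuous z)).
Qed.

Lemma pmf_le1 p z : is_pmf p -> p z <= 1.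
Proof.
by move=> [p0 <-]; rewrite (bigD1 z)//= lerDl sumr_ge0.
Qed.

Lemma compact_pmfs C : C `<=` is_pmf -> closedZ C ->
  compact (C : set {ptws Z -> R}).
Proof.
move=> Cpmf Cclosed.
have cpt := @tychonoff Z (fun=> R) (fun=> `[0, 1]%classic)
  (fun=> @segment_compact R 0 1).
apply: (@subclosed_compact {ptws Z -> R} C _ Cclosed cpt) => p /Cpmf p_pmf z /=.
by rewrite in_itv/= pmf_le1// andbT; case: p_pmf.
Qed.

Lemma expect_conv a b p c (t : R) :
  (forall z, p z = t * a z + (1 - t) * b z) ->
  expect p c = t * expect a c + (1 - t) * expect b c.
Proof.
move=> pE; rewrite /expect !mulr_sumr -big_split/=; apply: eq_bigr => z _.
by rewrite pE; ring.
Qed.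

(* Among the minimisers of [c], one of maximal Euclidean norm is extreme. *)
Lemma exists_ext_minimizer C c : C !=set0 -> C `<=` is_pmf -> closedZ C ->
  exists2 q, ext C q & forall r, C r -> expect q c <= expect r c.
Proof.
move=> C0 Cpmf Cclosed; have Cc := compact_pmfs Cpmf Cclosed.
have [m /set_mem Cm mmin] := @compact_EVT_min {ptws Z -> R} R _ C C0 Cc
  (continuous_subspaceT (@expect_continuous c)).
pose M : set {ptws Z -> R} := C `&` [set r | expect r c = expect m c].
have Mcl : closed M.
  apply: closedI => //.
  apply: (preimage_closed _ (@closed_eq _ (expect m c))) => p _; exact: expect_continuous.
have Mc : compact M by apply: (subclosed_compact Mcl Cc) => r [].
have M0 : M !=set0 by exists m.
have sqc : continuous (fun p : {ptws Z -> R} => \sum_z p z * p z).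
  apply: continuous_sum => z.
  exact: (continuous_mul (@eval_continuous z) (@eval_continuous z)).
have [q /set_mem[Cq qm] qmax] := @compact_EVT_max {ptws Z -> R} R _ M M0 Mc (continuous_subspaceT sqc).
have qmin r : C r -> expect q c <= expect r c.
  by move=> Cr; rewrite qm; apply/mmin/mem_set.
exists q => //; split => // a b t Ca Cb /andP[t0 t1] qE.
have qcE := expect_conv c qE.
have [ca cb] : expect a c = expect m c /\ expect b c = expect m c.
  rewrite -qm; exact: convex_comb_min t0 t1 qcE (qmin _ Ca) (qmin _ Cb).
have ha : \sum_z a z * a z <= \sum_z q z * q z by apply/qmax/mem_set.
have hb : \sum_z b z * b z <= \sum_z q z * q z by apply/qmax/mem_set.
(* Strict convexity of the squared norm: that of [q] falls short of the weighted mean of those of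
   [a] and [b] by t(1-t)|a-b|^2, so its maximality forces [a] and [b] to coincide. *)
have qqE : \sum_z q z * q z = t * (\sum_z a z * a z) +
    (1 - t) * (\sum_z b z * b z) - t * (1 - t) * \sum_z (a z - b z) ^+ 2.
  rewrite !mulr_sumr -sumrN -!big_split/=; apply: eq_bigr => z _.
  by rewrite qE; ring.
have ab0 : \sum_z (a z - b z) ^+ 2 = 0.
  have : 0 <= \sum_z (a z - b z) ^+ 2 by apply: sumr_ge0 => z _; exact: sqr_ge0.
  move=> S0; have t10 : 0 < 1 - t by rewrite subr_gt0.
  apply/eqP; rewrite eq_le S0 andbT -(pmulr_rle0 _ (mulr_gt0 t0 t10)).
  have := ler_wpM2l (ltW t0) ha; have := ler_wpM2l (ltW t10) hb.
  rewrite qqE; set U := t * \sum_z _; set V := (1 - t) * _.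
  by set W := t * (1 - t) * _; rewrite !mulrBr !mulrDr; lra.
have ab z : a z = b z.
  apply/eqP; rewrite -subr_eq0 -sqrf_eq0; apply/eqP.
  by move: z (erefl true); apply/psumr_eq0P => // z _; exact: sqr_ge0.
by split; apply/funext => z; rewrite qE ab; ring.
Qed.

End ExtremeMinimizer.

(** * Marginals and conditionals on full assignments *)

Section Assignments.
Context {R : realType} {N : finType} {T : N -> finType}.
Implicit Types (x : full T) (J : {set N}) (p : full T -> R).

Definition upd x (k : N) (a : T k) : full T := [ffun j => eqtype.dfwith x a j].

Lemma upd_in x k (a : T k) : upd x a k = a.
Proof. by rewrite ffunE eqtype.dfwith_in. Qed.

Lemma upd_out x k (a : T k) j : j != k -> upd x a j = x j.
Proof. by move=> jk; rewrite ffunE eqtype.dfwith_out// eq_sym. Qed.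

Lemma restrP J x x' :
  reflect (forall j, j \in J -> x j = x' j) (restr J x == restr J x').
Proof.
apply: (iffP eqP) => [xx' j jJ|xx']; last first.
  by apply/ffunP => -[j jJ]; rewrite !ffunE/= xx'.
by have := congr1 (fun y : asg T J => y (exist _ j jJ)) xx'; rewrite !ffunE.
Qed.

Lemma restr_upd J x k (a : T k) : k \notin J -> restr J (upd x a) = restr J x.
Proof.
move=> kJ; apply/eqP/restrP => j jJ; rewrite upd_out//.
by apply: contraNneq kJ => <-.
Qed.

Lemma restr_subset J J' x x' : (J \subset J')%SET ->
  restr J' x = restr J' x' -> restr J x = restr J x'.
Proof.
move=> /fintype.subsetP JJ' /eqP/restrP xx'.
by apply/eqP/restrP => j /JJ'; exact: xx'.
Qed.

Lemma restr_setU1 J x x' k (a : T k) : k \notin J ->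
  (restr (k |: J)%SET x' == restr (k |: J)%SET (upd x a)) =
  (x' k == a) && (restr J x' == restr J x).
Proof.
move=> kJ; apply/restrP/andP => [xx'|[/eqP x'k /restrP x'J] j].
  split; first by rewrite xx' ?setU11// upd_in.
  rewrite -(restr_upd x a kJ); apply/restrP => j jJ.
  by rewrite xx'// in_setU1 jJ orbT.
rewrite in_setU1 => /orP[/eqP ->|jJ]; first by rewrite upd_in.
by rewrite upd_out ?x'J//; apply: contraNneq kJ => <-.
Qed.

Lemma prob_setU1 p J x k (a : T k) : k \notin J ->
  prob p (restr (k |: J)%SET (upd x a)) =
  \sum_(x' : full T | (x' k == a) && (restr J x' == restr J x)) p x'.
Proof. by move=> kJ; apply: eq_bigl => x'; rewrite restr_setU1. Qed.

Lemma prob_sum_setU1 p J x k : k \notin J ->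
  prob p (restr J x) = \sum_a prob p (restr (k |: J)%SET (upd x (a : T k))).
Proof.
move=> kJ; rewrite /prob (partition_big (fun x' : full T => x' k) predT)//=.
apply: eq_bigr => a _; rewrite -/(prob _ _) prob_setU1//.
by apply: eq_bigl => x'; rewrite andbC.
Qed.

Lemma prob_ge0 p J (y : asg T J) : (forall x, 0 <= p x) -> 0 <= prob p y.
Proof. by move=> p0; apply: sumr_ge0. Qed.

Lemma prob_cond p k J (y : asg T J) a : 0 < prob p y ->
  prob p y * cond p k y a =
  \sum_(x : full T | (x k == a) && (restr J x == y)) p x.
Proof. by move=> p0; rewrite mulrC divfK// gt_eqF. Qed.

Lemma expect_cond p k J (y : asg T J) (f : T k -> R) : 0 < prob p y ->
  prob p y * expect (cond p k y) f =
  \sum_(x : full T | restr J x == y) p x * f (x k).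
Proof.
move=> p0; rewrite mulr_sumr.
rewrite [RHS](partition_big (fun x : full T => x k) predT)//=.
apply: eq_bigr => a _; rewrite mulrCA prob_cond// mulr_sumr.
by apply: eq_big => x; [rewrite andbC | move=> /andP[/eqP -> _]; rewrite mulrC].
Qed.

Lemma cond_pmf p k J (y : asg T J) : (forall x, 0 <= p x) -> 0 < prob p y ->
  is_pmf (cond p k y).
Proof.
move=> p0 py; split=> [a|]; first by rewrite divr_ge0 ?sumr_ge0// ltW.
have -> : \sum_a cond p k y a = expect (cond p k y) (fun=> 1).
  by apply: eq_bigr => a _; rewrite mul1r.
apply: (mulfI (lt0r_neq0 py)); rewrite expect_cond// mulr1.
by apply: eq_bigr => x _; rewrite mulr1.
Qed.

(** Multiplying by [prob p y] clears the denominator: a bound on the posterior, a ratio in [p],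
    becomes a sign condition linear in [p]. *)
Lemma expect_gap p k J (y : asg T J) (f : T k -> R) v : 0 < prob p y ->
  expect p (fun x => (restr J x == y)%:R * (f (x k) - v)) =
  prob p y * (expect (cond p k y) f - v).
Proof.
move=> py; rewrite mulrBr expect_cond// /prob mulr_suml -sumrB.
rewrite [RHS]big_mkcond; apply: eq_bigr => x _.
by case: eqP => _; rewrite ?mul0r// mul1r -mulrBr mulrC.
Qed.

(** Stated on full assignments, so that functions of different sets of coordinates share one type
    and multiply directly. *)
Definition depends_on J (F : full T -> R) :=
  forall x x', restr J x = restr J x' -> F x = F x'.

Lemma depends_onS J J' F : (J \subset J')%SET -> depends_on J F -> depends_on J' F.
Proof. by move=> JJ' FJ x x' /(restr_subset JJ')/FJ. Qed.

(** On a fibre of [restr J] both [A] and [L] are constant and [B] varies with coordinate [k] only.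
    The fibre sum for [B] is thus [A] times the fibre probability times a conditional expectation,
    and nonnegativity of [A] preserves the local inequality. *)
Lemma expect_cond_le p k J (A B L : full T -> R) :
  k \notin J -> (forall x, 0 <= p x) -> (forall x, 0 <= A x) ->
  depends_on J A -> depends_on (k |: J)%SET B -> depends_on J L ->
  (forall x, 0 < prob p (restr J x) ->
     L x <= expect (cond p k (restr J x)) (fun a => B (upd x a))) ->
  expect p (fun x => A x * L x) <= expect p (fun x => A x * B x).
Proof.
rewrite /expect; under eq_bigr do rewrite mulrC.
under [leRHS]eq_bigr do rewrite mulrC.
move=> kJ p0 A0 AJ BJ LJ hL.
rewrite (partition_big (restr J) predT)// [leRHS](partition_big (restr J) predT)//=.
apply: ler_sum => y _; have [x0 /eqP <-|none] := pickP [pred x | restr J x == y];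
  last by rewrite !big_pred0.
have : 0 <= prob p (restr J x0) by exact: prob_ge0.
(* On a fibre of probability zero, where [hL] says nothing, [p] vanishes and both sums are zero. *)
rewrite le_eqVlt => /orP[/eqP|] px0.
  have p_fib0 x : restr J x == restr J x0 -> p x = 0.
    move: x; apply/psumr_eq0P; first by move=> x _; exact: p0.
    by rewrite -/(prob _ _) -px0.
  by rewrite !big1// => x /p_fib0 ->; rewrite mul0r.
rewrite (eq_bigr (fun x => p x * (A x0 * L x0))); last first.
  by move=> x /eqP xx0; rewrite (AJ _ _ xx0) (LJ _ _ xx0).
rewrite -mulr_suml [leRHS](eq_bigr
  (fun x => A x0 * (p x * B (upd x0 (x k))))); last first.
  move=> x xx0; rewrite mulrCA (AJ _ _ (eqP xx0)); congr (_ * (_ * _)).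
  by apply/BJ/eqP; rewrite restr_setU1// eqxx.
rewrite -mulr_sumr mulrCA; apply: ler_wpM2l => //.
rewrite -(expect_cond (fun a => B (upd x0 a)))//.
by apply: ler_wpM2l; [exact: ltW | exact: hL].
Qed.

Lemma expect_cond_eq p k J (A B L : full T -> R) :
  k \notin J -> (forall x, 0 <= p x) -> (forall x, 0 <= A x) ->
  depends_on J A -> depends_on (k |: J)%SET B -> depends_on J L ->
  (forall x, 0 < prob p (restr J x) ->
     L x = expect (cond p k (restr J x)) (fun a => B (upd x a))) ->
  expect p (fun x => A x * L x) = expect p (fun x => A x * B x).
Proof.
move=> kJ p0 A0 AJ BJ LJ hL; apply/eqP; rewrite eq_le; apply/andP; split.
  by apply: (expect_cond_le kJ) => // x /hL ->.
have expectN (F : full T -> R) :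
    expect p (fun x => A x * - F x) = - expect p (fun x => A x * F x).
  by rewrite /expect -sumrN; apply: eq_bigr => x _; rewrite mulrN mulNr.
rewrite -lerN2 -!expectN.
apply: (expect_cond_le kJ) => // [x x' /BJ ->//|x x' /LJ ->//|x /hL ->].
by rewrite /expect -sumrN; apply: ler_sum => a _; rewrite mulNr.
Qed.

End Assignments.

(** * Vertices of the strong extension and their factorised marginals *)

Section Networks.
Context {R : realType} {N : finType} {T : N -> finType}.
Variable net : credal_network R T.
Let g := net_arc net.
Implicit Types (x : full T) (A : {set N}).

Definition vertex_pmf (q : forall i, asg T (pa g i) -> T i -> R) x :=
  \prod_i q i (restr (pa g i) x) (x i).

Definition ancestral A := forall j, j \in A -> (pa g j \subset A)%SET.

(** A member of [A] with the fewest ancestors works: a parent of it inside [A] would have strictly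
    fewer, by acyclicity. *)
Lemma exists_source A k0 : k0 \in A ->
  exists2 k, k \in A & (pa g k \subset ~: A)%SET.
Proof.
move=> k0A; pose rk k := #|[set j | connect g j k]%SET|.
have [k kA kmin] := arg_minnP rk k0A; exists k => //.
apply/fintype.subsetP => j; rewrite !inE => jk.
apply/negP => jA; have := kmin j jA; rewrite leqNgt => /negP; apply.
apply: proper_card; apply/properP; split.
  apply/fintype.subsetP => i; rewrite !inE => ij.
  exact: connect_trans ij (connect1 jk).
exists k; rewrite !inE ?connect0//; exact: arc_acyclic jk.
Qed.

Lemma ancestral_setU1 A k : ancestral A -> (pa g k \subset A)%SET ->
  ancestral (k |: A)%SET.
Proof.
move=> Aanc paA j; rewrite in_setU1 => /orP[/eqP ->|/Aanc jA].
  exact: fintype.subset_trans paA (finset.subsetUr _ _).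
exact: fintype.subset_trans jA (finset.subsetUr _ _).
Qed.

Lemma nd_ancestral k : ancestral (nd g k).
Proof.
move=> j; rewrite inE => /andP[jk nkj]; apply/fintype.subsetP => i.
rewrite !inE => ij; apply/andP; split.
  by apply: contraNneq nkj => <-; exact: connect1.
by apply: contraNN nkj => ki; exact: connect_trans ki (connect1 ij).
Qed.

Lemma pa_sub_nd k : (pa g k \subset nd g k)%SET.
Proof.
apply/fintype.subsetP => j; rewrite !inE => jk.
have kj := arc_acyclic jk; rewrite kj andbT.
by apply: contraNneq kj => ->.
Qed.

Lemma nd_self k : k \notin nd g k.
Proof. by rewrite inE eqxx. Qed.

Section Vertex.
Variable q : forall i, asg T (pa g i) -> T i -> R.
Hypothesis q_pmf : forall i y, is_pmf (@q i y).

Lemma vertex_pmf_ge0 x : 0 <= vertex_pmf q x.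
Proof. by apply: prodr_ge0 => i _; case: (q_pmf (restr (pa g i) x)). Qed.

Lemma prod_upd A k x (a : T k) : ancestral A -> (pa g k \subset A)%SET ->
  k \notin A ->
  \prod_(j in (k |: A)%SET) q (restr (pa g j) (upd x a)) (upd x a j) =
  q (restr (pa g k) x) a * \prod_(j in A) q (restr (pa g j) x) (x j).
Proof.
move=> Aanc /fintype.subsetP paA kA.
rewrite big_setU1//= restr_upd ?upd_in; last by apply: contraNN kA; exact: paA.
congr (_ * _); apply: eq_bigr => j jA; rewrite restr_upd ?upd_out//.
  by apply: contraNneq kA => <-.
by apply: contraNN kA; apply/fintype.subsetP/Aanc.
Qed.

(** Induction on the size of the complement: a node outside [A] with all parents in [A] is moved
    into [A], and summing over its values removes its factor, which is a pmf. *)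
Lemma prob_vertex_pmf A x : ancestral A ->
  prob (vertex_pmf q) (restr A x) =
  \prod_(j in A) q (restr (pa g j) x) (x j).
Proof.
have [n] := ubnP #|~: A|; elim: n A x => // n IHn A x An Aanc.
have [A0|[k0 k0A]] := set_0Vmem (~: A)%SET.
  have -> : A = [set: N]%SET by rewrite -[A]finset.setCK A0 finset.setC0.
  rewrite /prob (big_pred1 x) => [|x' /=].
    by apply: eq_bigl => j; rewrite inE.
  apply/restrP/eqP => [xx'|->//].
  by apply/ffunP => j; apply: xx'; rewrite inE.
have [k kA dpaA] := exists_source k0A.
have {kA}kA : k \notin A by rewrite inE in kA.
have paA : (pa g k \subset A)%SET.
  by rewrite finset.setCK in dpaA.
rewrite (prob_sum_setU1 _ x kA).
transitivity (\sum_a q (restr (pa g k) x) a *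
    \prod_(j in A) q (restr (pa g j) x) (x j)); last first.
  by rewrite -mulr_suml; case: (q_pmf (restr (pa g k) x)) => _ ->; rewrite mul1r.
apply: eq_bigr => a _; rewrite IHn ?prod_upd//; last exact: ancestral_setU1.
rewrite -ltnS; apply: leq_trans An; rewrite ltnS; apply: proper_card.
rewrite properC; apply/properP; split; first exact: finset.subsetUr.
by exists k; rewrite ?setU11.
Qed.

(** The marginals on [k |: A] and on [A] are products that differ by the factor of [k] alone. *)
Lemma cond_vertex_pmf A k x : ancestral A -> (pa g k \subset A)%SET ->
  k \notin A -> 0 < prob (vertex_pmf q) (restr A x) ->
  cond (vertex_pmf q) k (restr A x) = q (restr (pa g k) x).
Proof.
move=> Aanc paA kA p0; apply/funext => a.
have p_neq0 : prob (vertex_pmf q) (restr A x) != 0 by rewrite gt_eqF.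
apply: (mulfI p_neq0); rewrite prob_cond// -prob_setU1//.
rewrite !prob_vertex_pmf ?prod_upd//; first exact: mulrC.
exact: ancestral_setU1.
Qed.

End Vertex.

Definition selection (q : forall i, asg T (pa g i) -> T i -> R) : Prop :=
  forall i y, ext (local_set net y) (q i y).

Lemma local_pmf i (y : asg T (pa g i)) r : local_set net y r -> is_pmf r.
Proof. by case: (local_credal y) => + _ _; exact. Qed.

Lemma selection_pmf q : selection q -> forall i y, is_pmf (q i y).
Proof. by move=> qext i y; have [+ _] := qext i y; exact: local_pmf. Qed.

Lemma local_ext_min i (y : asg T (pa g i)) (c : T i -> R) :
  exists2 r, ext (local_set net y) r &
    forall s, local_set net y s -> expect r c <= expect s c.
Proof.
have [Cpmf Ccl _] := local_credal y.
exact: exists_ext_minimizer (local_nonempty y) Cpmf Ccl.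
Qed.

Lemma exists_selection : exists q, selection q.
Proof.
have ext0 i (y : asg T (pa g i)) : exists r, ext (local_set net y) r.
  by have [r] := local_ext_min y (fun=> 0); exists r.
exists (fun i => projT1 (boolp.choice (ext0 i))) => i y.
exact: (projT2 (boolp.choice (ext0 i))).
Qed.

Lemma strong_vertex q : selection q -> strong_extension net (vertex_pmf q).
Proof. by move=> qext; apply: sub_gen_smallest; exists q. Qed.

(** The set [nd g i] is ancestral, so conditioning on it returns the local pmf chosen at [i]. *)
Lemma epistemic_vertex q (x0 : full T) : selection q ->
  epistemic_extension net (vertex_pmf q).
Proof.
move=> qext; have qpmf := selection_pmf qext; split; last first.
  move=> i x p0; rewrite cond_vertex_pmf ?nd_self//.
  - by have [] := qext i (restr (pa g i) x).
  - exact: nd_ancestral.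
  - exact: pa_sub_nd.
split; first exact: vertex_pmf_ge0.
have set0_anc : ancestral finset.set0 by move=> j; rewrite inE.
have := prob_vertex_pmf qpmf x0 set0_anc; rewrite big_set0 => <-.
by apply: eq_bigl => x; apply/esym/restrP => j; rewrite inE.
Qed.

End Networks.

#[global] Arguments selection {R N T} net q.

(** * Lower bounds on expectations as closed convex half-spaces *)

Section HalfSpaces.
Context {R : realType} {Z : finType}.
Variables (c : Z -> R) (v : R).

Lemma convex_halfspace : convexZ [set r | v <= expect r c].
Proof.
move=> a b t; rewrite !inE/= => va vb.
rewrite (@expect_conv _ _ a b _ c t%:num)//.
have -> : v = t%:num * v + (1 - t%:num) * v by rewrite -mulrDl addrC subrK mul1r.
by apply: lerD; apply: ler_wpM2l => //; rewrite subr_ge0.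
Qed.

Lemma closed_halfspace : closedZ [set r | v <= expect r c].
Proof.
apply: (preimage_closed _ (@closed_ge _ v)) => p _; exact: expect_continuous.
Qed.

End HalfSpaces.

(** A closed convex half-space containing the generators contains their convex closure. *)
Lemma cond_credal_lbound (R : realType) (N : finType) (T : N -> finType)
    (C : set (full T -> R)) k (J : {set N}) (y : asg T J) (f : T k -> R) v :
  (forall p, C p -> 0 < prob p y -> v <= expect (cond p k y) f) ->
  lbound [set expect r f | r in cond_credal C k y] v.
Proof.
move=> Cv _ [r Cr <-]; apply: (smallest_sub (X := [set r | v <= expect r f]) _ _ Cr).
  by split; [exact: closed_halfspace | exact: convex_halfspace].
by move=> _ [p [Cp py] <-]; exact: Cv.
Qed.

(** * The hidden Markov graph and the backward minimisation *)

Section HiddenMarkov.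
Context {R : realType} {n : nat} {T : 'I_n.+1 -> finType}.
Variable net : credal_network R T.
Hypothesis net_hmm : forall j k, net_arc net j k <-> hmm_arc j k.
Hypothesis n_even : ~~ odd n.
Let g := net_arc net.

(* Indices start at 0, so the states have even index; the result is a singleton,
   or empty for [k = 0], and equals [pa g k] for [k <= n]. *)
Definition last_state (k : nat) : {set 'I_n.+1} :=
  [set j : 'I_n.+1 | ~~ odd j && ((k == j.+1) || (k == j.+2))]%SET.

Lemma pa_hmm k : pa g k = last_state k.
Proof.
apply/setP => j; rewrite !inE; apply/idP/idP => [/net_hmm|].
  case=> -[|i] [//= _ iodd]; rewrite /label => jE kE; subst i.
  by rewrite /= negbK in iodd; rewrite iodd; case: kE => -[->]; rewrite eqxx ?orbT.
case/andP => jeven jk; apply/net_hmm; exists j.+2; split => //=; last 2 first.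
- by rewrite negbK.
- by rewrite /label; case/orP: jk => /eqP ->; [left|right].
case/orP: jk => /eqP kE; last by have := ltn_ord k; rewrite kE ltnS.
(* Here [k] is odd and [n] even, so [k < n]; this keeps the manifest label [j.+2] of the arc at most
   [n]. *)
have kn : (k : nat) != n by apply: contraNneq n_even => <-; rewrite kE /= jeven.
by rewrite -kE ltn_neqAle kn -ltnS ltn_ord.
Qed.

Lemma arc_lt j k : g j k -> (j < k)%N.
Proof.
move=> jk; have : j \in pa g k by rewrite inE.
by rewrite pa_hmm inE => /andP[_ /orP[]/eqP ->].
Qed.

Lemma connect_le j k : connect g j k -> (j <= k)%N.
Proof.
case/connectP => s + ->; elim: s j => //= i s IHs j /andP[/arc_lt ji /IHs].
exact/leq_trans/ltnW.
Qed.

Lemma nd_lt (j k : 'I_n.+1) : (j < k)%N -> j \in nd g k.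
Proof.
move=> jk; rewrite inE; apply/andP; split.
  by apply: contraTneq jk => ->; rewrite ltnn.
by apply: contraTN jk => /connect_le; rewrite -leqNgt.
Qed.

(** Lets the recursion close: the last state before [k.+1] is [k] itself if [k] is a state, and
    otherwise the parent of [k]. *)
Lemma last_stateS (k : 'I_n.+1) : (last_state k.+1 \subset k |: pa g k)%SET.
Proof.
apply/fintype.subsetP => j; rewrite pa_hmm !inE !eqSS.
by case/andP => -> /orP[/eqP kj|->]; rewrite ?orbT// eq_sym; apply/orP; left;
  apply/eqP/val_inj.
Qed.

Lemma last_state_max : last_state n.+1 = [set ord_max]%SET.
Proof.
apply/setP => j; rewrite !inE !eqSS -val_eqE/= eq_sym.
have [->|jn]/= := eqVneq (j : nat) n; first by rewrite n_even.
apply/negbTE; apply: contraNN n_even => /andP[jeven /eqP nE].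
by rewrite nE/= jeven.
Qed.

Section Observation.
Variables (O : {set 'I_n.+1}) (xt : full T).

Definition obs (k : nat) (x : full T) : R :=
  \prod_(j in O | (j < k)%N) (x j == xt j)%:R.

Lemma obs_ge0 k x : 0 <= obs k x.
Proof. by apply: prodr_ge0 => j _; exact: ler0n. Qed.

Lemma obs0 x : obs 0 x = 1.
Proof. by rewrite /obs big_pred0// => j; rewrite andbF. Qed.

Lemma obsS (k : 'I_n.+1) x :
  obs k.+1 x = obs k x * (if k \in O then (x k == xt k)%:R else 1).
Proof.
rewrite /obs; case: ifP => kO; last first.
  rewrite mulr1; apply: eq_bigl => j; rewrite ltnS leq_eqVlt.
  by case: eqP => //= /val_inj ->; rewrite kO.
rewrite (bigD1 k)/=; last by rewrite kO ltnSn.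
rewrite mulrC; congr (_ * _); apply: eq_bigl => j.
by rewrite ltnS ltn_neqAle -andbA [(j <= k)%N && _]andbC.
Qed.

Lemma obs_full x : obs n.+1 x = (restr O x == restr O xt)%:R.
Proof.
rewrite /obs; have [xxt|/negP xxt] := boolP (restr O x == restr O xt).
  by rewrite big1// => j /andP[jO _]; rewrite (restrP _ _ _ xxt)// eqxx.
apply/eqP; apply: contra_notT xxt => /prodf_neq0 xxt.
apply/restrP => j jO; apply/eqP; have := xxt j; rewrite jO ltn_ord => /(_ isT).
by case: (x j == xt j) => //; rewrite mulr0n eqxx.
Qed.

(** Arcs increase the index, so nodes of smaller index are non-descendants; irrelevance can then be
    applied with the past observations held fixed. *)
Lemma obs_depends (k : 'I_n.+1) : depends_on (nd g k) (obs k).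
Proof.
move=> x x' /eqP/restrP xx'; apply: eq_bigr => j /andP[_ jk].
by rewrite xx'// nd_lt.
Qed.

(** The bound is claimed for every [q'] agreeing with [q] below [k]: choices at later nodes stay
    free, so the induction hypothesis still covers a selection whose factor at the next node has
    been replaced. *)
Lemma backward_induction (k : nat) (H : full T -> R) : (k <= n.+1)%N ->
  depends_on (last_state k) H ->
  exists2 q, selection net q & forall q', selection net q' ->
    (forall i : 'I_n.+1, (i < k)%N -> q' i = q i) ->
    forall p, epistemic_extension net p ->
    expect (vertex_pmf q') (fun x => obs k x * H x) <=
    expect p (fun x => obs k x * H x).
Proof.
elim: k H => [|k IHk] H kn HD.
  (* No state precedes index 0, so [H] is constant and both sides equal its value. *)
  have [q qsel] := exists_selection net; exists q => // q' q'sel _ p [[_ p1] _].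
  have [[_ q1] _] := epistemic_vertex xt q'sel.
  have HE (x : full T) : H x = H xt by apply/HD/eqP/restrP => j; rewrite !inE andbF.
  have expE r : \sum_x r x = 1 -> expect r (fun x => obs 0 x * H x) = H xt.
    move=> r1; rewrite -[RHS]mulr1 -r1 mulr_sumr.
    by apply: eq_bigr => x _; rewrite obs0 mul1r HE.
  by rewrite !expE.
pose i : 'I_n.+1 := Ordinal kn.
pose B (x : full T) := (if i \in O then (x i == xt i)%:R else 1) * H x.
have BD : depends_on (i |: pa g i)%SET B.
  move=> x x' xx'; congr (_ * _); last first.
    by apply: HD; apply: restr_subset xx'; exact: (last_stateS i).
  by case: ifP => // _; move/eqP/restrP: xx' => ->//; rewrite setU11.
have obsSB (x : full T) : obs k.+1 x * H x = obs k x * B x by rewrite (obsS i) mulrA.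
have expSB r : expect r (fun x => obs k.+1 x * H x) =
    expect r (fun x => obs k x * B x).
  by apply: eq_bigr => x _; rewrite obsSB.
have ipa : i \notin pa g i.
  by apply/negP; rewrite inE => /arc_lt; rewrite ltnn.
have BDupd (x x' : full T) (a : T i) : restr (pa g i) x = restr (pa g i) x' ->
    B (upd x a) = B (upd x' a).
  move=> xx'; apply/BD/eqP; rewrite restr_setU1// upd_in eqxx restr_upd//.
  exact/eqP.
(* The functional minimised at [i] depends on [x] only through the parent value [y], so one extreme
   point serves all [x] extending [y]; a [y] without extension receives any extreme point. *)
have r_ex (y : asg T (pa g i)) : exists r, ext (local_set net y) r /\
    forall x : full T, restr (pa g i) x = y -> forall s, local_set net y s ->
      expect r (fun a => B (upd x a)) <= expect s (fun a => B (upd x a)).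
  have [x0 /eqP <-|none] := pickP [pred x : full T | restr (pa g i) x == y].
    have [r rext rmin] := local_ext_min (restr (pa g i) x0) (fun a => B (upd x0 a)).
    exists r; split => // x xx0 s /rmin; congr (_ <= _);
      by apply: eq_bigr => a _; rewrite (BDupd _ _ a xx0).
  have [r rext _] := local_ext_min y (fun=> 0).
  by exists r; split => // x xy; have := none x; rewrite /= xy eqxx.
have [r rP] := boolp.choice r_ex.
(* The minimal conditional expectation is a function of the parent and takes the place of [H] at
   stage [k]. *)
pose L (x : full T) := expect (r (restr (pa g i) x)) (fun a => B (upd x a)).
have LD : depends_on (pa g i) L.
  move=> x x' xx'; rewrite /L xx'.
  by apply: eq_bigr => a _; rewrite (BDupd _ _ a xx').
have [|q0 q0sel IH] := IHk L (ltnW kn); first by rewrite pa_hmm in LD.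
pose q := eqtype.dfwith q0 r.
have qi : q i = r by exact: eqtype.dfwith_in.
exists q => [j|q' q'sel q'q p ep].
  have [<- y|ij y] := eqVneq i j; first by rewrite qi; have [] := rP y.
  by rewrite /q eqtype.dfwith_out.
have q'i : q' i = r by rewrite q'q.
have nd_i := nd_self net i.
have BDnd : depends_on (i |: nd g i)%SET B.
  by apply: depends_onS BD; apply: finset.setUS; exact: pa_sub_nd.
have {}LD := depends_onS (pa_sub_nd net i) LD; have obsD := @obs_depends i.
(* Under the vertex, [B] may be replaced by [L] with equality. The induction hypothesis then passes
   to [p] with [L], and minimality of [r] to [p] with [B]. *)
rewrite !expSB -(@expect_cond_eq _ _ _ _ i (nd g i) (obs k) B L)//.
- apply: (@le_trans _ _ (expect p (fun x => obs k x * L x))).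
    apply: IH => // j jk; rewrite q'q ?ltnS 1?ltnW// /q eqtype.dfwith_out//.
    by apply: contraTneq jk => <-; rewrite ltnn.
  case: ep => -[p0 _] ep; apply: (expect_cond_le nd_i) => //; first exact: obs_ge0.
  move=> x px; have [_ rmin] := rP (restr (pa g i) x).
  by apply: rmin => //; exact: ep.
- by apply: vertex_pmf_ge0; exact: selection_pmf q'sel.
- exact: obs_ge0.
- move=> x px; rewrite cond_vertex_pmf ?q'i//.
  + exact: selection_pmf q'sel.
  + exact: nd_ancestral.
  + exact: pa_sub_nd.
Qed.

End Observation.

End HiddenMarkov.

(** * Comparison of the two posterior lower expectations *)

Lemma prob_le1 (R : realType) (N : finType) (T : N -> finType)
    (p : full T -> R) (J : {set N}) (y : asg T J) : is_pmf p -> prob p y <= 1.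
Proof.
move=> [p0 <-]; rewrite /prob big_mkcond; apply: ler_sum => x _.
by case: ifP.
Qed.

Lemma expect_ge (R : realType) (Z : finType) (p f : Z -> R) :
  is_pmf p -> - \sum_z `|f z| <= expect p f.
Proof.
move=> p_pmf; rewrite -sumrN; apply: ler_sum => z _.
have [p0 _] := p_pmf; rewrite lerNl -mulNr.
apply: le_trans (ler_wpM2r (p0 z) (ler_norm (- f z))) _.
by rewrite normrN ler_piMr// pmf_le1.
Qed.

Theorem theorem1 (R : realType) (n : nat) (n_ge2 : (2 <= n)%N)
    (n_even : ~~ odd n) (T : 'I_n.+1 -> finType) (net : credal_network R T)
    (net_hmm : forall j k, net_arc net j k <-> hmm_arc j k)
    (O : {set 'I_n.+1}) (O_manifest : forall i, i \in O -> manifest i)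
    (xO : asg T O)
    (strong_pos : exists2 v : R,
       is_min [set prob p xO | p in strong_extension net] v & 0 < v)
    (epistemic_pos : exists2 v : R,
       is_min [set prob p xO | p in epistemic_extension net] v & 0 < v)
    (f : T ord_max -> R) :
  exists v : R,
    is_lower_expectation (cond_credal (epistemic_extension net) ord_max xO) f v
    /\ is_lower_expectation (cond_credal (strong_extension net) ord_max xO) f v.
Proof.
have [v0 [[p0 _ p0E] v0lb] v0pos] := strong_pos.
have [x0 x0O] : exists x0, restr O x0 = xO.
  have [x0 /eqP x0O|none] := pickP [pred x | restr O x == xO]; first by exists x0.
  by move: v0pos; rewrite -p0E /prob big_pred0// ltxx.
have vertex_pos q : selection net q -> 0 < prob (vertex_pmf q) xO.
  move=> qsel; apply: lt_le_trans v0pos (v0lb _ _).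
  by exists (vertex_pmf q) => //; exact: strong_vertex.
have epi_pos p : epistemic_extension net p -> 0 < prob p xO.
  have [v1 [_ v1lb] v1pos] := epistemic_pos.
  by move=> pepi; apply: lt_le_trans v1pos (v1lb _ _); exists p.
pose post p := expect (cond p ord_max xO) f.
pose V : set R := [set post (vertex_pmf q) | q in selection net].
have V0 : V !=set0.
  by have [q qsel] := exists_selection net; exists (post (vertex_pmf q)), q.
have Vlb : has_lbound V.
  exists (- \sum_a `|f a|) => _ [q qsel <-]; apply/expect_ge/cond_pmf.
    by apply: vertex_pmf_ge0; exact: selection_pmf.
  exact: vertex_pos.
pose v := inf V; have v_le q : selection net q -> v <= post (vertex_pmf q).
  by move=> qsel; apply: ge_inf => //; exists q.
pose gain x := obs O x0 n.+1 x * (f (x ord_max) - v).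
have gainE p : 0 < prob p xO -> expect p gain = prob p xO * (post p - v).
  move=> /(expect_gap f v) <-; apply: eq_bigr => x _.
  by rewrite /gain obs_full x0O.
have fv_depends : depends_on (last_state n.+1) (fun x => f (x ord_max) - v).
  move=> x x'; rewrite (last_state_max n_even) => /eqP/restrP xx'.
  by rewrite xx'// inE.
have [q qsel qmin] :=
  backward_induction net_hmm n_even O x0 (leqnn _) fv_depends.
have {}qmin p : epistemic_extension net p -> expect (vertex_pmf q) gain <= expect p gain.
  exact: qmin.
(* Were this posterior above [v], the gain of [q] would be positive, and some [q1] would have a
   posterior below [v] plus that gain. Since probabilities are at most 1, the gain of [q1] is at
   most its posterior minus [v], contradicting the minimality of [q]. *)
have post_q : post (vertex_pmf q) = v.
  apply/eqP; rewrite eq_le v_le// andbT leNgt; apply/negP => vq.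
  have gain_gt0 : 0 < expect (vertex_pmf q) gain.
    by rewrite gainE ?vertex_pos// mulr_gt0 ?vertex_pos// subr_gt0.
  have [_ [q1 q1sel <-]] := inf_adherent gain_gt0 (conj V0 Vlb).
  apply/negP; rewrite -leNgt -lerBrDl.
  have q1epi := epistemic_vertex x0 q1sel.
  apply: le_trans (qmin _ q1epi) _; rewrite gainE ?vertex_pos//.
  rewrite ler_piMl ?subr_ge0 ?v_le//; apply: prob_le1.
  by case: q1epi.
have gain_ge0 p : epistemic_extension net p -> 0 <= expect p gain.
  move=> /qmin; apply: le_trans; rewrite gainE ?vertex_pos//.
  by rewrite post_q subrr mulr0.
have post_ge p : 0 < prob p xO -> 0 <= expect p gain -> v <= post p.
  by move=> p_gt0; rewrite gainE// pmulr_rge0// subr_ge0.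
(* One argument for both extensions: membership of the minimising vertex gives attainment,
   nonnegative gain gives the bound. *)
have lower C : C (vertex_pmf q) -> (forall p, C p -> 0 <= expect p gain) ->
    is_lower_expectation (cond_credal C ord_max xO) f v.
  move=> Cq Cgain; split; last first.
    by apply: cond_credal_lbound => p /Cgain ? p_gt0; exact: post_ge.
  exists (cond (vertex_pmf q) ord_max xO) => //.
  by apply: sub_gen_smallest; exists (vertex_pmf q) => //; split => //; exact: vertex_pos.
exists v; split; apply: lower => //.
- exact: epistemic_vertex.
- exact: strong_vertex.
(* Nonnegative gain defines a convex half-space, so it passes from the vertices to their hull. *)
- apply: smallest_sub; first exact: convex_halfspace.
  move=> p [q1 [q1sel pE]]; rewrite (_ : p = vertex_pmf q1); last exact/funext.
  by apply: gain_ge0; exact: epistemic_vertex.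
Qed.
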